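(* There is a constant $C$ such that for every sequence length $N\ge1$ there exist a precision $p\le C\max\{1,\log N\}$ and a fifth-order graph transformer $f\in\mathcal{TG}^{1,1,\otimes5}_{N,1,1,p}$ with a single graph self-attention unit (embedding dimension $1$) such that $f(X)=\mathrm{Cycle5}(X)$ for all $X\in\{0,1\}^{N\times N}$ with $X=X^{\mathsf T}$ (where $f$ may use a positional encoding and a single appended blank token, as specified in the context).
   Context: The input $X\in\{0,1\}^{N\times N}$ is the adjacency matrix of a graph on $[N]=\{1,\dots,N\}$, $x_{i,j}=1$ iff $(i,j)$ is an edge; row $x_i$ is the embedding of vertex $i$. For symmetric $X$, $\mathrm{Cycle5}(X)\in\{0,1\}^N$ is given by $\mathrm{Cycle5}(X)_i=1$ if there exist $j_1,j_2,j_3,j_4\in[N]$ with $x_{i,j_1}x_{j_1,j_2}x_{j_2,j_3}x_{j_3,j_4}x_{j_4,i}=1$, and $0$ otherwise. Tensor notation. $(v^1\otimes v^2)_{(i_1-1)N_2+i_2}=v^1_{i_1}v^2_{i_2}$ for $v^1\in\mathbb{R}^{N_1},v^2\in\mathbb{R}^{N_2}$; for matrices with $m$ columns, $A^1\star A^2=[A^1_1\otimes A^2_1\mid\cdots\mid A^1_m\otimes A^2_m]$ (column-wise Kronecker product). $s$-order graph self-attention. Let $X$ be the adjacency matrix given as input to the network and $Y\in\mathbb{R}^{N\times d}$ the current embeddings. For $Q,K^1,\dots,K^{s-1}\in\mathbb{R}^{d\times m}$, $V^1,\dots,V^{s-1}\in\mathbb{R}^{d\times d'}$ encoded with $p$-bit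 fixed-point numbers and a function $\kappa:\{0,1\}^{s(s-1)}\times\mathbb{R}\to\mathbb{R}$, the unit outputs $$\mathrm{softmax}\big(\kappa(X,YQ((YK^1)\star\cdots\star(YK^{s-1}))^{\mathsf T})\big)\big((YV^1)\star\cdots\star(YV^{s-1})\big)\in\mathbb{R}^{N\times d'},$$ where the attention matrix is viewed as a tensor $A$ indexed by $(i_1,\dots,i_s)\in[N]^s$ ($i_1$ the row, $(i_2,\dots,i_s)$ the column), $\kappa(X,A)_{i_1,\dots,i_s}=\kappa\big((x_{i_a,i_b})_{a\neq b\in[s]},A_{i_1,\dots,i_s}\big)$, and softmax is row-wise, $\mathrm{softmax}(A)_{i,j}=\exp(A_{i,j})/\sum_{j'}\exp(A_{i,j'})$. MLP layer. $\Phi_{d,d',p}$ is the set of all (arbitrary) functions $\phi:\mathbb{R}^d\to\mathbb{R}^{d'}$ whose real-valued inputs and outputs can be represented using $p$-bit fixed-precision numbers, applied row-wise. $\mathcal{TG}^{1,1,\otimes s}_{d,m,d',p}$ is the set of compositions of an input MLP in $\Phi_{d,m,p}$, one $s$-order graph self-attention unit with input, embedding and output dimensions all $m$, and an output MLP in $\Phi_{m,d',p}$. Conventions. Positional encoding: MLPs may depend on the index $i$. Blank token: a single constant token may be appended to the sequence as element $N+1$, with all edge indicators involving it equal to $0$; the output is read off the first $N$ elements. *)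

(* Defs.v *)
From mathcomp Require Import all_boot all_order all_algebra.
From mathcomp Require Import mxtens.
From mathcomp Require Import reals sequences.
From mathcomp Require Import exp.

Set Implicit Arguments.
Unset Strict Implicit.
Unset Printing Implicit Defensive.

Import Order.TTheory GRing.Theory Num.Theory.

Local Open Scope ring_scope.

Section FixedPoint.
Variable R : realType.

(* Two's complement fixed-point numbers with p bits in total, q of which are
   fractional; q < p, one of the bits being the sign bit. *)
Definition fixed_min (p : nat) : int := - 2 ^+ p.-1.
Definition fixed_max (p : nat) : int := 2 ^+ p.-1 - 1.

Definition fixed_point (p q : nat) (x : R) : Prop :=
  exists2 k : int, fixed_min p <= k <= fixed_max p & x = k%:~R / 2 ^+ q.

(* Rounding to a nearest such number (half-way cases upwards), with
   saturation outside of the representable range. *)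
Definition fixed_round (p q : nat) (x : R) : R :=
  (Num.max (fixed_min p)
     (Num.min (fixed_max p) (Num.floor (x * 2 ^+ q + 2^-1))))%:~R / 2 ^+ q.

Definition fixed_mx (p q m n : nat) (A : 'M[R]_(m, n)) : Prop :=
  forall i j, fixed_point p q (A i j).

(* A row-wise map on sequences of length n; the first argument is the position
   of the row in the sequence (positional encoding). *)
Definition mlp (n d d' : nat) := 'I_n -> 'rV[R]_d -> 'rV[R]_d'.

Definition mlp_apply (n d d' : nat) (phi : mlp n d d') (Y : 'M[R]_(n, d)) :
    'M[R]_(n, d') :=
  \matrix_(i < n) phi i (row i Y).

(* phi is otherwise arbitrary: it reads its real inputs with p bits and its
   outputs are p-bit numbers. *)
Definition mlp_class (n d d' p q : nat) (phi : mlp n d d') : Prop :=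
  forall (i : 'I_n) (x : 'rV[R]_d),
    phi i x = phi i (map_mx (fixed_round p q) x) /\ fixed_mx p q (phi i x).

End FixedPoint.

Section StarProduct.
Variable R : realType.

Definition star (n1 n2 m : nat) (A : 'M[R]_(n1, m)) (B : 'M[R]_(n2, m)) :
    'M[R]_(n1 * n2, m) :=
  \matrix_(r, c) (A (mxtens_unindex r).1 c * B (mxtens_unindex r).2 c).

(* n ^ k, in a form that unfolds by computation *)
Fixpoint tensor_dim (n k : nat) : nat :=
  if k is k'.+1 then (n * tensor_dim n k')%N else 1%N.

(* A 0 star (A 1 star ( ... )); the empty product is the all-ones row, which is
   neutral for star. *)
Fixpoint star_prod (n m k : nat) :
    ('I_k -> 'M[R]_(n, m)) -> 'M[R]_(tensor_dim n k, m) :=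
  match k with
  | 0 => fun _ => const_mx 1
  | k'.+1 => fun A =>
      star (A ord0) (star_prod (fun a : 'I_k' => A (lift ord0 a)))
  end.

(* The multi-index (i_1, ..., i_k) of a row of star_prod *)
Fixpoint multi_index (n k : nat) : 'I_(tensor_dim n k) -> k.-tuple 'I_n :=
  match k with
  | 0 => fun _ => [tuple]
  | k'.+1 => fun r =>
      cons_tuple (mxtens_unindex r).1 (multi_index (mxtens_unindex r).2)
  end.

End StarProduct.

Section GraphTransformer.
Variable R : realType.

Definition softmax (n k : nat) (A : 'M[R]_(n, k)) : 'M[R]_(n, k) :=
  \matrix_(i, j) (expR (A i j) / \sum_j' expR (A i j')).

Definition edge_index (s : nat) := {ab : 'I_s * 'I_s | ab.1 != ab.2}.

Definition edge_indicators (n s : nat) (X : 'M[bool]_n) (t : s.-tuple 'I_n) :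
    {ffun edge_index s -> bool} :=
  [ffun ab => X (tnth t (val ab).1) (tnth t (val ab).2)].

(* An attention unit of order k + 1 has one query and k keys and values. *)
Record attention_unit (k d m d' : nat) := AttentionUnit {
  query : 'M[R]_(d, m);
  key : 'I_k -> 'M[R]_(d, m);
  value : 'I_k -> 'M[R]_(d, d');
  kappa : {ffun edge_index k.+1 -> bool} -> R -> R }.

Definition attention_class (k d m d' p q : nat)
    (u : attention_unit k d m d') : Prop :=
  [/\ fixed_mx p q (query u),
      forall a, fixed_mx p q (key u a) &
      forall a, fixed_mx p q (value u a)].

Definition kappa_mx (n k d m d' : nat) (u : attention_unit k d m d')
    (X : 'M[bool]_n) (A : 'M[R]_(n, tensor_dim n k)) :
    'M[R]_(n, tensor_dim n k) :=
  \matrix_(i, r)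
    kappa u (edge_indicators X (cons_tuple i (multi_index r))) (A i r).

Definition attention (n k d m d' : nat) (u : attention_unit k d m d')
    (X : 'M[bool]_n) (Y : 'M[R]_(n, d)) : 'M[R]_(n, d') :=
  softmax (kappa_mx u X
    (Y *m query u *m (star_prod (fun a => Y *m key u a))^T))
  *m star_prod (fun a => Y *m value u a).

(* One layer, one attention unit of order s >= 2; blank tells whether the
   token blank_token is appended to the sequence. *)
Record graph_transformer (N s d m d' : nat) := GraphTransformer {
  blank : bool;
  blank_token : 'rV[R]_d;
  mlp_in : mlp R (N + blank) d m;
  self_attention : attention_unit s.-1 m m m;
  mlp_out : mlp R (N + blank) m d' }.
Arguments mlp_in {N s d m d'} g : rename.
Arguments mlp_out {N s d m d'} g : rename.

(* A single format (p, q) is used by the whole network. *)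
Definition TG (N s d m d' p : nat) (f : graph_transformer N s d m d') : Prop :=
  exists2 q : nat, (q < p)%N &
    [/\ mlp_class p q (mlp_in f),
        attention_class p q (self_attention f) &
        mlp_class p q (mlp_out f)].

Definition extend_graph (N b : nat) (X : 'M[bool]_N) : 'M[bool]_(N + b) :=
  block_mx X (const_mx false) (const_mx false) (const_mx false).

Definition transform (N s d m d' : nat) (f : graph_transformer N s d m d')
    (X : 'M[bool]_N) (Z : 'M[R]_(N, d)) : 'M[R]_(N, d') :=
  let Z' := col_mx Z (\matrix_(_ < blank f) blank_token f) in
  let Y := mlp_apply (mlp_in f) Z' in
  usubmx (mlp_apply (mlp_out f)
    (attention (self_attention f) (extend_graph (blank f) X) Y)).

Definition real_of_bool_mx (m n : nat) (X : 'M[bool]_(m, n)) : 'M[R]_(m, n) :=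
  map_mx (fun b : bool => b%:R) X.

(* f(X): row i of the adjacency matrix is the input embedding of vertex i. *)
Definition eval_graph (N s m d' : nat) (f : graph_transformer N s N m d')
    (X : 'M[bool]_N) : 'M[R]_(N, d') :=
  transform f X (real_of_bool_mx X).

End GraphTransformer.

Definition cycle5 (N : nat) (X : 'M[bool]_N) : 'cV[bool]_N :=
  \col_i [exists j1, exists j2, exists j3, exists j4,
    [&& X i j1, X j1 j2, X j2 j3, X j3 j4 & X j4 i]].

(* Main.v *)
Require Import Defs.
From mathcomp Require Import all_boot all_order all_algebra.
From mathcomp Require Import mxtens.
From mathcomp Require Import reals sequences.
From mathcomp Require Import exp.
From mathcomp Require Import lra.

(** Embed every vertex as 1 and the blank token as 0, with identity query, keys
    and values: the attention score and the value at [(i, j1, ..., j4)] are then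
    both 1 if all the [j]s are vertices and 0 if one of them is blank. Let
    [kappa] be [L] on closed walks of length 5, [0] on the other tuples with a
    blank, and [- L] on the remaining ones. For [L] large the softmax puts most
    of its mass on closed walks (value 1) if there is one, and otherwise on
    tuples with a blank (value 0), so rounding the output to an integer
    decides; since [1 + L <= exp L], taking for [L] twice the number of columns
    is enough. As [kappa] is not restricted in precision, [p = 2] suffices. *)

Set Implicit Arguments.
Unset Strict Implicit.
Unset Printing Implicit Defensive.

Import Order.TTheory GRing.Theory Num.Theory.

Local Open Scope ring_scope.

(** * Rounding to fixed-point numbers *)

Section FixedRound.
Variable R : realType.

Lemma fixed_min_le_max p : fixed_min p <= fixed_max p.
Proof.
rewrite /fixed_min /fixed_max.
have : (1 : int) <= 2 ^+ p.-1 by rewrite exprn_ege1.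
by lra.
Qed.

Lemma fixed_round_point p q (x : R) : fixed_point p q (fixed_round p q x).
Proof.
rewrite /fixed_round; set k := Num.max _ _; exists k => //.
by rewrite /k le_max lexx ge_max fixed_min_le_max ge_min lexx.
Qed.

Lemma fixed_round_id p q (x : R) : fixed_point p q x -> fixed_round p q x = x.
Proof.
case=> k /andP[kmin kmax] ->; rewrite /fixed_round divfK ?expf_neq0 ?pnatr_eq0 //.
have -> : Num.floor (k%:~R + 2^-1 : R) = k.
  by apply: floor_def; rewrite intrD; apply/andP; split; lra.
by rewrite min_r // max_r.
Qed.

(** This lets the output MLP turn an approximate attention value into an exact bit: an error below
    one half leaves the floor of [x + 2^-1] at [k]. *)
Lemma fixed_round_int p (k : int) (x : R) : fixed_min p <= k <= fixed_max p ->
  `|x - k%:~R| < 2^-1 -> fixed_round p 0 x = k%:~R.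
Proof.
move=> /andP[kmin kmax]; rewrite ltr_norml => /andP[xl xr].
rewrite /fixed_round expr0 mulr1 divr1.
have -> : Num.floor (x + 2^-1) = k.
  by apply: floor_def; rewrite intrD; apply/andP; split; lra.
by rewrite min_r // max_r.
Qed.

Lemma mlp_class_const n d d' p q (c : 'I_n -> 'rV[R]_d') :
  (forall i, fixed_mx p q (c i)) -> mlp_class p q (fun i (_ : 'rV[R]_d) => c i).
Proof. by move=> c_fixed i x; split. Qed.

(** Rounding is idempotent, because its results are representable. *)
Lemma mlp_class_round n d p q :
  mlp_class p q (fun (_ : 'I_n) (x : 'rV[R]_d) => map_mx (fixed_round p q) x).
Proof.
move=> _ x; split=> [|i j]; last by rewrite mxE; exact: fixed_round_point.
by apply/matrixP => i j; rewrite !mxE [RHS]fixed_round_id //; exact: fixed_round_point.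
Qed.

End FixedRound.

(** * Concentration of softmax under a score gap *)

Section Softmax.
Variables (R : realType) (n k : nat).
Implicit Type A : 'M[R]_(n, k).

Lemma sum_expR_gt0 A i (j0 : 'I_k) : 0 < \sum_j expR (A i j).
Proof.
rewrite (bigD1 j0) //= ltr_wpDr ?expR_gt0 //.
by apply: sumr_ge0 => j _; exact: expR_ge0.
Qed.

Lemma softmax_sum1 A i (j0 : 'I_k) : \sum_j softmax A i j = 1.
Proof.
under eq_bigr do rewrite mxE.
by rewrite -mulr_suml divff // gt_eqF // (sum_expR_gt0 _ _ j0).
Qed.

(** Each column in [P] weighs at most [w / (1 + 2k)], with [w] the weight of [j0]. There are at most
    [k] of them and [w] is at most the normalizer, so their mass is at most [k / (1 + 2k)]. *)
Lemma softmax_sum_lt_half A i (P : pred 'I_k) j0 :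
  (forall j, P j -> A i j + (2 * k)%:R <= A i j0) ->
  \sum_(j | P j) softmax A i j < 2^-1.
Proof.
move=> PA; under eq_bigr do rewrite mxE.
have Z0 := sum_expR_gt0 A i j0.
rewrite -mulr_suml ltr_pdivrMr //.
set w := expR (A i j0); have w0 : 0 < w by exact: expR_gt0.
have wZ : w <= \sum_j expR (A i j).
  by rewrite (bigD1 j0) //= lerDl; apply: sumr_ge0 => j _; exact: expR_ge0.
have Pw j : P j -> expR (A i j) <= w / (1 + (2 * k)%:R).
  move=> /PA Ajw; rewrite -ler_expR expRD in Ajw.
  rewrite ler_pdivlMr ?ltr_pwDl //; apply: le_trans Ajw.
  by rewrite ler_pM2l ?expR_gt0 // expR_ge1Dx.
have Sw : \sum_(j | P j) expR (A i j) <= w / (1 + (2 * k)%:R) *+ k.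
  apply: (le_trans (ler_sum _ Pw)); rewrite (sumr_const P).
  rewrite -!(mulr_natr (w / _)) ler_wpM2l //; first by rewrite divr_ge0 ?addr_ge0 // ltW.
  by rewrite ler_nat -[leqRHS]card_ord max_card.
apply: (le_lt_trans Sw); apply: (@lt_le_trans _ _ (2^-1 * w)); last first.
  by rewrite ler_pM2l ?invr_gt0.
rewrite -mulr_natr mulrAC ltr_pdivrMr ?ltr_pwDl // natrM.
by have : 0 <= (k%:R : R) by []; nra.
Qed.

End Softmax.

(** * Entries and columns of iterated star products *)

Section StarProd.
Variable R : realType.

Lemma star_prodE n m k (A : 'I_k -> 'M[R]_(n, m)) r c :
  star_prod A r c = \prod_(a < k) A a (tnth (multi_index r) a) c.
Proof.
elim: k A r => [|k IHk] A r; first by rewrite big_ord0 mxE.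
rewrite big_ord_recl /= mxE IHk tnth0; congr (_ * _).
by apply: eq_bigr => a _; rewrite tnthS.
Qed.

Lemma multi_index_surj n k (t : k.-tuple 'I_n) :
  exists r : 'I_(tensor_dim n k), multi_index r = t.
Proof.
elim: k t => [|k IHk] t; first by exists ord0; rewrite [RHS]tuple0.
case/tupleP: t => x t; have [r rt] := IHk t.
have [u uE] : exists u, mxtens_unindex u = (x, r).
  by exists (mxtens_index (x, r)); rewrite mxtens_indexK.
exists u.
change (cons_tuple (mxtens_unindex u).1 (multi_index (mxtens_unindex u).2)
        = cons_tuple x t).
by rewrite uE rt.
Qed.

End StarProd.

(** * Closed walks read off the edge indicators *)

Section ClosedWalk.

Definition closed_walk_pattern s (e : {ffun edge_index s -> bool}) : bool :=
  [forall ab, ((val ab).2 == ordS (val ab).1) ==> e ab].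

Lemma closed_walk_patternP n s (X : 'M[bool]_n) (t : s.+2.-tuple 'I_n) :
  reflect (forall a, X (tnth t a) (tnth t (ordS a)))
          (closed_walk_pattern (edge_indicators X t)).
Proof.
apply: (iffP forallP) => [Xt a | Xt ab]; last first.
  by apply/implyP => /eqP ab_next; rewrite ffunE ab_next.
(* Edge indicators exist only off the diagonal; a cyclic successor differs from its argument since
   the tuple has at least two entries. *)
have a_next : (a, ordS a).1 != (a, ordS a).2.
  rewrite -val_eqE /= ; case: (ltngtP a.+1 s.+2) (ltn_ord a) => // [lt_a|eq_a] _.
    by rewrite modn_small // neq_ltn leqnn.
  by rewrite eq_a modnn; case: (val a) eq_a.
by have := Xt (exist _ (a, ordS a) a_next); rewrite ffunE /= eqxx.
Qed.

Lemma extend_graphE N b (X : 'M[bool]_N) i j :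
  extend_graph b X (lshift b i) (lshift b j) = X i j.
Proof. by rewrite /extend_graph block_mxEul. Qed.

Lemma extend_graph_vertex N b (X : 'M[bool]_N) u v :
  extend_graph b X u v -> exists i, u = lshift b i.
Proof.
rewrite -(splitK u) -(splitK v).
case: (split u) => i /=; first by exists i.
by case: (split v) => j /=; rewrite /extend_graph ?block_mxEdl ?block_mxEdr mxE.
Qed.

(** Every entry of a closed walk is the source of an edge, hence a vertex, so the blank token
    creates no new walks. *)
Lemma cycle5P N b (X : 'M[bool]_N) i :
  reflect (exists t : 4.-tuple 'I_(N + b),
             closed_walk_pattern
               (edge_indicators (extend_graph b X) (cons_tuple (lshift b i) t)))
          (cycle5 X i 0).
Proof.
rewrite mxE; apply: (iffP idP) => [|[t]].
  case/existsP=> j1 /existsP[j2 /existsP[j3 /existsP[j4 /and5P[e1 e2 e3 e4 e5]]]].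
  exists [tuple lshift b j1; lshift b j2; lshift b j3; lshift b j4].
  apply/closed_walk_patternP; case; do 5?[case=> [|//]|case]; move=> // a5;
  by rewrite !(tnth_nth (lshift b i)) /= extend_graphE.
case/tupleP: t => u1 t; case/tupleP: t => u2 t; case/tupleP: t => u3 t.
case/tupleP: t => u4 t; rewrite (tuple0 t) {t} => /closed_walk_patternP walk.
(* The reduction modulo 5 is that of [ordS]: the last edge returns to [i]. *)
have e (m : nat) : (m < 5)%N -> extend_graph b X
    (nth (lshift b i) [:: lshift b i; u1; u2; u3; u4] m)
    (nth (lshift b i) [:: lshift b i; u1; u2; u3; u4] (m.+1 %% 5)).
  by move=> m5; have := walk (Ordinal m5); rewrite !(tnth_nth (lshift b i)).
have /= e0 := e 0 isT; have /= e1 := e 1 isT; have /= e2 := e 2 isT.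
have /= e3 := e 3 isT; have /= e4 := e 4 isT.
have [j1 j1E] := extend_graph_vertex e1; have [j2 j2E] := extend_graph_vertex e2.
have [j3 j3E] := extend_graph_vertex e3; have [j4 j4E] := extend_graph_vertex e4.
move: e0 e1 e2 e3 e4; rewrite j1E j2E j3E j4E !extend_graphE => e0 e1 e2 e3 e4.
apply/existsP; exists j1; apply/existsP; exists j2.
by apply/existsP; exists j3; apply/existsP; exists j4; apply/and5P.
Qed.

End ClosedWalk.

(** * The transformer and its correctness *)

Section Transformer.
Variables (R : realType) (N : nat).

Definition gap : R := (2 * tensor_dim (N + true) 4)%:R.

Definition cycle5_unit : attention_unit R 5.-1 1 1 1 :=
  {| query := 1; key := fun=> 1; value := fun=> 1;
     kappa := fun e a =>
       if closed_walk_pattern e then gap else if a == 0 then 0 else - gap |}.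

(** The graph enters only through [kappa]. The input MLP uses the position alone, the blank token
    being at index [N]. *)
Definition cycle5_transformer : graph_transformer R N 5 N 1 1 :=
  {| blank := true;
     blank_token := 0;
     mlp_in := fun i _ => const_mx (i < N)%:R;
     self_attention := cycle5_unit;
     mlp_out := fun _ => map_mx (fixed_round 2 0) |}.

(** Two bits, none fractional, represent the integers from -2 to 1, which include both bit
    values. *)
Lemma cycle5_transformer_TG : TG 2 cycle5_transformer.
Proof.
have fixed_bool (b : bool) : fixed_point 2 0 (b%:R : R).
  by exists b%:Z; rewrite ?expr0 ?divr1 ?pmulrn //; case: b.
have fixed1 : fixed_mx 2 0 (1 : 'M[R]_1) by move=> i j; rewrite mxE.
exists 0 => //; split => //=.
- by apply: mlp_class_const => i r c; rewrite mxE.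
- exact: mlp_class_round.
Qed.

Let vertices (r : 'I_(tensor_dim (N + true) 4)) : bool :=
  [forall a, tnth (multi_index r) a < N]%N.

Let Y : 'M[R]_(N + true, 1) := \col_i (i < N)%:R.

Lemma star_prod_vertices r :
  star_prod (fun _ : 'I_4 => Y *m 1) r 0 = (vertices r)%:R.
Proof.
rewrite star_prodE mulmx1; under eq_bigr do rewrite mxE.
rewrite /vertices; case: forallP => [all_v|/forallP].
  by rewrite big1 // => a _; rewrite all_v.
rewrite negb_forall => /existsP[a /negbTE a_blank].
by rewrite (bigD1 a) //= a_blank mul0r.
Qed.

(** A vertex has query 1, so its score is the indicator of a blank-free tuple; this is how [kappa]
    detects blanks. *)
Lemma kappa_mx_cycle5 (X : 'M[bool]_(N + true)) (i : 'I_N) r :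
  kappa_mx cycle5_unit X
    (Y *m 1 *m (star_prod (fun _ : 'I_4 => Y *m 1))^T) (lshift true i) r =
  if closed_walk_pattern
       (edge_indicators X (cons_tuple (lshift true i) (multi_index r)))
  then gap else if vertices r then - gap else 0.
Proof.
have score : (Y *m 1 *m (star_prod (fun _ : 'I_4 => Y *m 1))^T)
    (lshift true i) r = (vertices r)%:R.
  rewrite mxE big_ord1 [_^T _ _]mxE star_prod_vertices mulmx1 mxE.
  by rewrite [nat_of_ord _]/= ltn_ord mul1r.
rewrite mxE score; cbn [kappa cycle5_unit].
by case: (vertices r); rewrite ?oner_eq0 ?eqxx.
Qed.

Lemma cycle5_attention (X : 'M[bool]_N) (i : 'I_N) :
  `|attention cycle5_unit (extend_graph true X) Y (lshift true i) 0
    - (cycle5 X i 0)%:R| < 2^-1.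
Proof.
rewrite /attention mxE; under eq_bigr do rewrite star_prod_vertices.
set B := kappa_mx _ _ _.
have BE := kappa_mx_cycle5 (extend_graph true X) i; rewrite -/B in BE.
have S0 (P : pred 'I_(tensor_dim (N + true) 4)) :
    0 <= \sum_(r | P r) softmax B (lshift true i) r.
  apply: sumr_ge0 => r _; rewrite mxE divr_ge0 ?expR_ge0 //.
  by apply: sumr_ge0 => j _; exact: expR_ge0.
have -> : \sum_r softmax B (lshift true i) r * (vertices r)%:R =
    \sum_(r | vertices r) softmax B (lshift true i) r.
  rewrite [RHS]big_mkcond; apply: eq_bigr => r _.
  by case: vertices; rewrite ?mulr1 ?mulr0.
have gap0 : 0 <= gap by [].
case: (cycle5P true X i) => [[t walk]|no_walk] /=.
  have [r0 r0E] := multi_index_surj t.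
  (* The total mass is 1, so the error is the mass [T] of the tuples with a blank. *)
  have := softmax_sum1 B (lshift true i) r0; rewrite (bigID vertices) /=.
  set S := \sum_(r | vertices r) _; set T := \sum_(r | _) _ => ST.
  have T0 : 0 <= T by exact: S0.
  suff T_half : T < 2^-1 by rewrite ltr_norml; apply/andP; split; lra.
  apply: (@softmax_sum_lt_half _ _ _ _ _ _ r0) => r /negbTE blank_r.
  (* A blank has no outgoing edge, so such a column is no closed walk and gets 0, against [gap] at
     [r0]. *)
  rewrite !BE blank_r r0E walk ifF ?add0r //; apply/negbTE/negP.
  move=> /closed_walk_patternP walk_r; move/negP: blank_r; apply.
  apply/forallP => a; have := walk_r (lift ord0 a).
  by rewrite tnthS => /extend_graph_vertex[j ->]; rewrite /= ltn_ord.
rewrite subr0 ger0_norm ?S0 //.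
(* Without a walk, the all-blank column gets 0 and dominates the blank-free ones at [- gap]. *)
have [r0 r0E] := multi_index_surj (nseq_tuple 4 (rshift N (ord0 : 'I_true))).
have no_walk_r (r : 'I_(tensor_dim (N + true) 4)) :
    closed_walk_pattern (edge_indicators (extend_graph true X)
      (cons_tuple (lshift true i) (multi_index r))) = false.
  by apply/negP => walk; apply: no_walk; exists (multi_index r).
have blank_r0 : vertices r0 = false.
  apply/negP => /forallP /(_ ord0); rewrite r0E tnth_nseq /=.
  by rewrite addn0 ltnn.
apply: (@softmax_sum_lt_half _ _ _ _ _ _ r0) => r vertices_r.
by rewrite !BE !no_walk_r vertices_r blank_r0 addNr.
Qed.

Lemma eval_cycle5_transformer (X : 'M[bool]_N) :
  eval_graph cycle5_transformer X = real_of_bool_mx R (cycle5 X).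
Proof.
apply/matrixP => i j; rewrite (ord1 j) {j}.
(* This exposes the output as the rounding of a single attention entry. *)
rewrite [LHS]mxE [LHS]mxE [LHS]mxE [X in fixed_round _ _ X]mxE.
rewrite [RHS]mxE pmulrn; apply: fixed_round_int; first by case: (cycle5 X i 0).
have -> : mlp_apply (mlp_in (g := cycle5_transformer))
    (col_mx (real_of_bool_mx R X) (\matrix_(_ < true) 0)) = Y.
  by apply/matrixP => u v; rewrite !mxE.
exact: cycle5_attention.
Qed.

End Transformer.

Theorem theorem22 (R : realType) :
  exists C : R, forall N : nat, (1 <= N)%N ->
    exists (p : nat) (f : graph_transformer R N 5 N 1 1),
      [/\ p%:R <= C * Num.max 1 (ln (N%:R : R)),
          TG p f &
          forall X : 'M[bool]_N, X = X^T ->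
            eval_graph f X = real_of_bool_mx R (cycle5 X)].
Proof.
exists 2 => N _; exists 2, (cycle5_transformer R N); split.
- by rewrite ler_peMr // le_max lexx.
- exact: cycle5_transformer_TG.
- by move=> X _; exact: eval_cycle5_transformer.
Qed.
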